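(* Let $G$ be a simple $n$-vertex graph of Euler genus $g$, diameter $D$, and maximum degree $\Delta\ge 6$. Then, for every positive integer $L$, the number of simple paths in $G$ of length $L$ is at most $2n\,2^{L}\,6^{L/2-3g}\,\Delta^{L/2+3g}$.
   Context: All graphs are finite, simple, undirected and connected. The Euler genus of a graph is the minimum Euler genus of a surface on which the graph can be drawn without crossing edges. A simple path of length $L$ is a sequence of $L+1$ distinct vertices in which consecutive vertices are adjacent. *)

(* Defs.v *)
From HB Require Import structures.
From mathcomp Require Import all_boot all_order all_algebra.

Set Implicit Arguments.
Unset Strict Implicit.
Unset Printing Implicit Defensive.

Import Order.TTheory GRing.Theory Num.Theory.

Definition step2 (T : finType) (a b : T -> T) : rel T :=
  [rel x y | (y == a x) || (y == b x)].

Definition step3 (T : finType) (a b c : T -> T) : rel T :=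
  [rel x y | [|| y == a x, y == b x | y == c x]].

(** A closed connected surface (orientable or not), presented by a cell
    decomposition.  The decomposition is encoded by its flags, i.e. the
    triangles of its barycentric subdivision, each with one corner in a vertex,
    one in an edge and one in a face: [flip0 x], [flip1 x], [flip2 x] is the
    flag glued to [x] along the side opposite to its vertex, edge, face corner
    respectively.  Every side is glued to the side of another flag, so there is
    no boundary, and the four flags around each edge are
    [x], [flip0 x], [flip2 x], [flip0 (flip2 x)].  The 1-skeleton may have
    loops and parallel edges. *)
Record surface := Surface {
  flag :> finType;
  flip0 : flag -> flag;
  flip1 : flag -> flag;
  flip2 : flag -> flag;
  flip0K : involutive flip0;
  flip1K : involutive flip1;
  flip2K : involutive flip2;
  flip0_neq : forall x, flip0 x != x;
  flip1_neq : forall x, flip1 x != x;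
  flip2_neq : forall x, flip2 x != x;
  flip02C : forall x, flip0 (flip2 x) = flip2 (flip0 x);
  flip02_neq : forall x, flip0 (flip2 x) != x;
  flag_inhabited : 0 < #|flag|;
  flag_connected : forall x y, connect (step3 flip0 flip1 flip2) x y
}.

Section Surface.
Variable S : surface.

(** A cell of the decomposition is the set of flags incident with it: an orbit
    under the flips that keep this cell. *)
Definition same_vertex : rel S := connect (step2 (@flip1 S) (@flip2 S)).

Definition vertex_number : nat := n_comp (step2 (@flip1 S) (@flip2 S)) predT.
Definition edge_number : nat := n_comp (step2 (@flip0 S) (@flip2 S)) predT.
Definition face_number : nat := n_comp (step2 (@flip0 S) (@flip1 S)) predT.

Definition surface_euler_char : int :=
  (vertex_number%:Z - edge_number%:Z + face_number%:Z)%R.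

Definition surface_euler_genus : int := (2 - surface_euler_char)%R.

End Surface.

Section Graph.
Variables (T : finType) (e : rel T).

(** A drawing without crossings: the vertices of the graph are distinct
    vertices of the decomposition ([p u] is any flag at the vertex of [u]), and
    each edge of the graph is an edge of the decomposition joining its ends.
    Edges of a simple graph have distinct pairs of ends, hence are automatically
    drawn as distinct edges.  The 1-skeleton may have further vertices and
    edges, so the faces of the drawing itself need not be discs. *)
Definition drawing_on (S : surface) (p : T -> S) : Prop :=
  (forall u v, same_vertex (p u) (p v) -> u = v) /\
  (forall u v, e u v ->
     exists x : S, same_vertex (p u) x /\ same_vertex (p v) (flip0 x)).

Definition drawable_on (S : surface) : Prop := exists p : T -> S, drawing_on p.

Definition has_euler_genus (g : nat) : Prop :=
  (exists S : surface, drawable_on S /\ surface_euler_genus S = g%:Z%R) /\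
  (forall S : surface, drawable_on S -> (g%:Z <= surface_euler_genus S)%R).

(** The value is [#|T|] when there is no walk from [u] to [v]. *)
Definition graph_dist (u v : T) : nat :=
  find (fun k => [exists w : k.-tuple T, path e u w && (last u w == v)])
       (iota 0 #|T|).

Definition graph_diameter : nat := \max_(u : T) \max_(v : T) graph_dist u v.

Definition max_degree : nat := \max_(u : T) #|[set v | e u v]|.

Definition simple_paths (L : nat) : {set L.+1.-tuple T} :=
  [set w : L.+1.-tuple T | sorted e w && uniq w].

End Graph.

(* Main.v *)
Require Import Defs.
From mathcomp Require Import all_boot all_order all_algebra.
From mathcomp Require Import reals exp.
From mathcomp Require Import zify ring lra.

(** The bound rests on the sparsity of graphs of bounded genus.  Write [g] for
    the Euler genus; a nonempty vertex set [U] carries at most [3|U| + 3g]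
    edges ([card_arcs], which counts every edge twice), so if [|U| > 6g] some
    vertex of [U] has at most 6 neighbours in [U].  Removing such vertices as
    long as possible leaves a core [C] of at most [6g] vertices; orienting each
    edge outside the core from the end that was removed first gives every
    vertex out-degree at most 6 ([sparse_orientation]).

    A walk that extends along an oriented arc has at most 6 choices, and at most
    [Delta] otherwise.  Give such steps the weights [1/6] and [1/Delta].  The
    weights of the steps leaving a vertex sum to at most 2, so all walks of
    length [L] have total weight at most [n 2^L], and so they have when
    they are read backwards.  Each edge outside the core is oriented one way or
    the other, and a simple path has at most [6g] steps inside the core; hence
    the product of the forward and backward weights of a simple path is at least
    [(6 Delta)^-L (6/Delta)^(6g)] ([uniq_path_weight_both]).  By the inequality
    of arithmetic and geometric means the sum of the two weights is at least
    twice the square root of this, which is twice the inverse of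
    [6^(L/2-3g) Delta^(L/2+3g)]; summing over all simple paths gives the bound
    ([card_walks_weight]).

    The edge bound is Euler's inequality for a drawing whose faces need not be
    discs.  Let [A] be a set of edges of a cell decomposition of the surface,
    with all ends in a nonempty set [W] of vertices.  Cutting the surface along
    [A] leaves at least [|A| - |W| + 2 - g] regions, where a region is a class
    of faces linked across edges outside [A].  If [W] consists of all
    vertices this holds because each edge outside [A] merges at most two
    regions ([region_colouring_faces]).  Otherwise some edge [a] joins [W] to
    a vertex outside [W]; adding this edge to [A] and its new end to [W] leaves
    the right-hand side unchanged, and creates no new region because one can
    walk from one side of [a] to the other around the new vertex
    ([region_colouring_edge_orbitU], [region_colouring_exists]).  On the other
    hand the edges bounding a region meet each vertex evenly, so in a simple
    graph with at least two edges each region has at least three sides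
    ([region_sides]); as every edge has two sides, this bounds the number of
    regions by two thirds of the number of edges. *)

Set Implicit Arguments.
Unset Strict Implicit.
Unset Printing Implicit Defensive.

Import Order.TTheory GRing.Theory Num.Theory.

(** * Regions of a surface cut along edges *)

Lemma even_card_involution (T : finType) (f : T -> T) (A : {set T}) :
  involutive f -> (forall x, x \in A -> f x != x) ->
  (forall x, x \in A -> f x \in A) -> ~~ odd #|A|.
Proof.
move=> fK; have [n] := ubnP #|A|; elim: n A => // n IHn A ltAn neq_f Af.
have [->|[x xA]] := set_0Vmem A; first by rewrite cards0.
have fxA : f x \in A :\ x by rewrite !inE neq_f ?Af.
move: ltAn; rewrite (cardsD1 x) xA (cardsD1 (f x)) fxA /= negbK => ltAn.
apply: IHn => [|y|y]; first by lia.
  by rewrite !inE => /and3P[_ _ /neq_f].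
rewrite !inE => /and3P[yfx yx /Af ->]; rewrite andbT (inj_eq (inv_inj fK)) yx /=.
by apply: contraNneq yfx => <-; rewrite fK.
Qed.

Lemma step2_connect_sym (T : finType) (a b : T -> T) :
  involutive a -> involutive b -> connect_sym (step2 a b).
Proof.
move=> aK bK; apply: sym_connect_sym => x y; rewrite /step2 /=.
by rewrite ![y == _]eq_sym (inv_eq aK) (inv_eq bK).
Qed.

Section Surface.
Variable S : surface.
Local Notation flip0 := (@flip0 S).
Local Notation flip1 := (@flip1 S).
Local Notation flip2 := (@flip2 S).
Implicit Types (x y z : S) (A W : {set S}) (c : S -> S).

(** A set of vertices of the decomposition is represented below by the set of
    these representatives, so that its cardinal counts vertices. *)
Definition vertex_root : S -> S := fingraph.root (step2 flip1 flip2).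

Lemma same_vertexE x y : same_vertex x y = (vertex_root x == vertex_root y).
Proof.
by rewrite /same_vertex root_connect //; apply/step2_connect_sym/flip2K/flip1K.
Qed.

Lemma vertex_root_flip1 x : vertex_root (flip1 x) = vertex_root x.
Proof.
apply/eqP; rewrite eq_sym -same_vertexE; apply: connect1.
by rewrite /step2 /= eqxx.
Qed.

Lemma vertex_root_flip2 x : vertex_root (flip2 x) = vertex_root x.
Proof.
apply/eqP; rewrite eq_sym -same_vertexE; apply: connect1.
by rewrite /step2 /= eqxx orbT.
Qed.

Lemma flips_transitive (P : pred S) x y :
  (forall z, P z -> [/\ P (flip0 z), P (flip1 z) & P (flip2 z)]) -> P x -> P y.
Proof.
move=> Pflip Px; have /connectP[s] := flag_connected x y.
elim: s x Px => /= [|z s IHs] x Px; first by move=> _ ->.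
by case/andP=> xz; apply: IHs; have [? ? ?] := Pflip x Px; case/or3P: xz => /eqP->.
Qed.

Definition edge_orbit x : {set S} :=
  [set x; flip0 x; flip2 x; flip0 (flip2 x)].

Lemma card_edge_orbit x : #|edge_orbit x| = 4.
Proof.
have f0 := inj_eq (inv_inj (@flip0K S)).
have : uniq [:: x; flip0 x; flip2 x; flip0 (flip2 x)].
  rewrite /= !inE !negb_or f0 !(eq_sym x) flip0_neq flip2_neq flip02_neq.
  rewrite (inv_eq (@flip0K S)) (eq_sym x) flip02_neq /=.
  by rewrite eq_sym flip0_neq.
move/card_uniqP => /= <-; apply: eq_card => y.
by rewrite !inE -!orbA.
Qed.

(** Sets of edges are represented by all their flags: the cardinal of such a set
    is four times the number of edges. *)
Definition edge_set A :=
  forall x, ((flip0 x \in A) = (x \in A)) * ((flip2 x \in A) = (x \in A)).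

Lemma edge_set_orbitU A x : edge_set A -> edge_set (A :|: edge_orbit x).
Proof.
move=> Aedge y; have f0 := inv_eq (@flip0K S); have f2 := inv_eq (@flip2K S).
split; rewrite !inE Aedge; congr (_ || _).
  rewrite !f0 !(@flip0K S).
  by case: (y == x); case: (y == flip0 x); case: (y == flip2 x); case: (y == _).
rewrite !f2 -!(@flip02C S) !(@flip2K S).
by case: (y == x); case: (y == flip0 x); case: (y == flip2 x); case: (y == _).
Qed.

Lemma card_edge_orbitU A x :
  edge_set A -> x \notin A -> #|A :|: edge_orbit x| = #|A| + 4.
Proof.
move=> Aedge xA; rewrite -(card_edge_orbit x) cardsU.
rewrite (_ : A :&: _ = set0) ?cards0 ?subn0 //.
apply/setP=> y; rewrite !inE; apply/negP=> /andP[yA].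
by rewrite -!orbA => /or4P[] /eqP yx; move: xA; rewrite -?yx ?Aedge;
  move: yA; rewrite yx ?Aedge => ->.
Qed.

Lemma card_flags : #|S| <= 4 * edge_number S.
Proof.
rewrite mulnC /edge_number /n_comp_mem -sum_nat_const -sum1_card.
pose r := fingraph.root (step2 flip0 flip2).
have csym : connect_sym (step2 flip0 flip2)
  by apply/step2_connect_sym/flip2K/flip0K.
rewrite (partition_big r [predI fingraph.roots (step2 flip0 flip2) & predT]); last first.
  by move=> x _; rewrite !inE roots_root.
apply: leq_sum => y _; rewrite sum1_card -(card_edge_orbit y) subset_leq_card //.
apply/subsetP=> x; rewrite !inE => /eqP <-.
have : connect (step2 flip0 flip2) (r x) x by rewrite csym connect_root.
move: (r x) => {}y /connectP[s].
elim/last_ind: s x => [|s z IHs] x /=; first by move=> _ ->; rewrite eqxx.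
rewrite rcons_path last_rcons => /andP[ys zx] ->.
move/(_ _ ys (erefl _)): IHs; case/orP: zx => /eqP->; last first.
  rewrite -!orbA => /or4P[]/eqP->; rewrite -?flip02C ?flip2K ?eqxx ?orbT //.
by rewrite -!orbA => /or4P[]/eqP->; rewrite ?flip0K ?eqxx ?orbT.
Qed.

(** The surface is cut along the edges of [A], and every piece is given one
    colour.  Different pieces may share a colour, so the number of colours is a
    lower bound for the number of pieces; merging two colours is easier than
    following what happens to connected components. *)
Definition region_colouring A c := forall x,
  [/\ c (flip0 x) = c x, c (flip1 x) = c x & x \notin A -> c (flip2 x) = c x].

Definition colours c : {set S} := [set c x | x : S].

(** Starting from the colouring of the faces by distinct colours, crossing one
    more edge identifies at most two colours.  The term [#|~: A|] is four times
    the number of edges that may be crossed. *)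
Lemma region_colouring_faces A :
  edge_set A ->
  exists2 c, region_colouring A c &
    4 * face_number S <= 4 * #|colours c| + #|~: A|.
Proof.
have [n] := ubnP #|~: A|; elim: n A => // n IHn A ltAn Aedge.
have [A0|[x]] := set_0Vmem (~: A).
  have csym : connect_sym (step2 flip0 flip1)
    by apply/step2_connect_sym/flip1K/flip0K.
  exists (fingraph.root (step2 flip0 flip1)).
    move=> x; split; last by rewrite -in_setC A0 inE.
      apply/esym/eqP; rewrite root_connect //; apply: connect1.
      by rewrite /step2 /= eqxx.
    apply/esym/eqP; rewrite root_connect //; apply: connect1.
    by rewrite /step2 /= eqxx orbT.
  rewrite A0 cards0 addn0 leq_mul2l /=.
  apply/subset_leq_card/subsetP => x; rewrite !inE andbT => /eqP <-.
  exact: imset_f.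
rewrite inE => xA.
have [] := IHn (A :|: edge_orbit x) _ (edge_set_orbitU x Aedge).
  have := cardsC A; have := cardsC (A :|: edge_orbit x).
  rewrite card_edge_orbitU //; lia.
move=> c cA lec.
(* The colours of the two sides of the edge of [x] are merged. *)
pose m (y : S) := if y == c x then c (flip2 x) else y.
exists (fun z => m (c z)).
  move=> z; have [c0 c1 c2] := cA z; split; rewrite ?c0 ?c1 // => zA.
  have [|zx] := boolP (z \in edge_orbit x); last by rewrite c2 // inE negb_or zA.
  have c0x y : c (flip0 y) = c y by have [] := cA y.
  have mx : m (c (flip2 x)) = m (c x) by rewrite /m eqxx; case: eqP.
  rewrite !inE -!orbA => /or4P[]/eqP->;
    by rewrite ?flip02C ?flip2K -?flip02C ?c0x.
have : #|colours c :\ c x| <= #|colours (fun z => m (c z))|.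
  apply/subset_leq_card/subsetP=> y; rewrite !inE => /andP[yx /imsetP[z _ yz]].
  by apply/imsetP; exists z => //; rewrite -yz /m (negPf yx).
have := cardsD1 (c x) (colours c).
have := cardsC A; have := cardsC (A :|: edge_orbit x).
rewrite card_edge_orbitU //; move: lec; case: (_ \in _); lia.
Qed.

(** Cutting along a further edge [a] that has a free end separates nothing: the
    two sides of [a] are linked by a walk around that end.  In place of the walk
    the proof uses parity.  Were the colours of the two sides different, the
    flags at the free end with the colour of [a] would be paired by [flip1], and
    all of them but [a] would be paired by [flip2]. *)
Lemma region_colouring_edge_orbitU A c a :
  region_colouring (A :|: edge_orbit a) c ->
  (forall x, vertex_root x = vertex_root a -> x \notin A) ->
  vertex_root (flip0 a) != vertex_root a ->
  region_colouring A c.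
Proof.
move=> cA aA loopless.
have vE := (vertex_root_flip1, vertex_root_flip2).
have c0 y : c (flip0 y) = c y by have [] := cA y.
have c1 y : c (flip1 y) = c y by have [] := cA y.
suff c2a : c (flip2 a) = c a.
  move=> x; split=> // xA.
  have [|xa] := boolP (x \in edge_orbit a); last first.
    by have [_ _ ->] := cA x; rewrite // inE negb_or xA.
  by rewrite !inE -!orbA => /or4P[]/eqP->;
    rewrite -?flip02C ?c0 ?flip2K.
apply/eqP/negPn/negP => c2a.
pose Z := [set z | (vertex_root z == vertex_root a) && (c z == c a)].
have aZ : a \in Z by rewrite !inE !eqxx.
have even_Z : ~~ odd #|Z|.
  apply: (even_card_involution (@flip1K S)) => z; first by rewrite flip1_neq.
  by rewrite !inE vE c1.
have : ~~ odd #|Z :\ a|.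
  apply: (even_card_involution (@flip2K S)) => z; first by rewrite flip2_neq.
  rewrite !inE => /and3P[za /eqP va /eqP ca].
  have zA : z \notin A :|: edge_orbit a.
    rewrite inE negb_or aA //= !inE !negb_or za -!andbA /=; apply/and3P; split.
    - by apply: contraNneq loopless => <-; rewrite va.
    - by apply: contraNneq c2a => <-; rewrite ca.
    - by apply: contraNneq loopless; rewrite -va => ->; rewrite flip02C vE.
  have [_ _ ->] := cA z; rewrite // vE va ca !eqxx !andbT.
  by apply: contraNneq c2a => z2; rewrite -z2 flip2K ca z2.
by move: even_Z; rewrite (cardsD1 a) aZ /= negbK => ->.
Qed.

(** Euler's inequality for a graph drawn on the surface: if [A] consists of
    [m] edges, at least [2 - g + m - |W|] colours can be used, all terms being
    multiplied by four.  The induction enlarges [W] one vertex at a time along an edge that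
    leaves [W]. *)
Lemma region_colouring_exists A W b :
  edge_set A -> vertex_root b \in W -> (forall x, x \in A -> vertex_root x \in W) ->
  exists2 c, region_colouring A c &
    4 * (vertex_number S + face_number S) + #|A|
      <= 4 * (#|colours c| + edge_number S + #|W|).
Proof.
have [n] := ubnP #|~: W|; elim: n A W => // n IHn A W ltWn Aedge Wb AW.
have [allW|] := boolP [forall x, vertex_root x \in W].
  have [c cA lec] := region_colouring_faces Aedge; exists c => //.
  have : vertex_number S <= #|W|.
    apply/subset_leq_card/subsetP => x; rewrite !inE andbT => /eqP <-.
    exact: (forallP allW).
  by have := card_flags; have := cardsC A; lia.
rewrite negb_forall => /existsP[x xW].
have [a aW faW] : exists2 a, vertex_root a \notin W & vertex_root (flip0 a) \in W.
  have [/existsP[a /andP[? ?]]|] :=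
    boolP [exists a, (vertex_root a \notin W) && (vertex_root (flip0 a) \in W)].
    by exists a.
  rewrite negb_exists => /forallP noa; case/negP: xW.
  apply: (@flips_transitive (fun x => vertex_root x \in W) b) => // z zW.
  rewrite vertex_root_flip1 vertex_root_flip2; split=> //.
  by have := noa (flip0 z); rewrite flip0K zW andbT negbK.
have aA : a \notin A by apply: contra aW => /AW.
have [||||c cA lec] := IHn (A :|: edge_orbit a) (vertex_root a |: W).
- move: (cardsC W) (cardsC (vertex_root a |: W)); rewrite cardsU1 aW /=; lia.
- exact: edge_set_orbitU.
- by rewrite inE Wb orbT.
- move=> z; rewrite !inE -!orbA.
  by case/orP=> [/AW ->|/or4P[]/eqP->];
    rewrite ?flip02C ?vertex_root_flip2 ?faW ?eqxx ?orbT.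
exists c; first apply: (region_colouring_edge_orbitU cA) => [z za|].
- by apply: contra aW => /AW; rewrite za.
- by apply: contraNneq aW => <-.
by move: lec; rewrite card_edge_orbitU // cardsU1 aW; lia.
Qed.

(** The flags of one edge at one of its ends are [x] and [flip2 x]; any other
    flag with the same two ends would belong to a parallel edge. *)
Definition simple_edges A :=
  {in A, forall x, vertex_root (flip0 x) != vertex_root x} /\
  {in A &, forall x y, vertex_root x = vertex_root y ->
     vertex_root (flip0 x) = vertex_root (flip0 y) -> y = x \/ y = flip2 x}.

(** A region whose boundary is empty is the whole surface, and then all flags of
    [A] lie on it.  Otherwise the boundary [B] of the region meets each vertex
    in an even number of flags.  Going from a boundary edge at each of its ends
    to another one, and along that to its other end, reaches three different
    vertices, each with two flags of [B].  Six flags are three sides, since a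
    side of an edge has two flags. *)
Lemma region_sides A c k :
  edge_set A -> simple_edges A -> region_colouring A c -> 6 <= #|A| ->
  k \in colours c -> 6 <= #|[set x in A | c x == k]|.
Proof.
move=> Aedge [loopless simple] cA le6A /imsetP[x0 _ ->{k}].
set k := c x0.
have vE := (vertex_root_flip1, vertex_root_flip2).
have c0 y : c (flip0 y) = c y by have [] := cA y.
have c1 y : c (flip1 y) = c y by have [] := cA y.
pose B := [set x in A | (c x == k) && (c (flip2 x) != k)].
have [B0|[b bB]] := set_0Vmem B.
  rewrite (_ : [set x in A | _] = A) //; apply/setP=> x; rewrite !inE.
  apply/andb_idr => _; apply: (@flips_transitive (fun x => c x == k) x0).
    move=> z /eqP cz; rewrite c0 c1 cz eqxx; split=> //.
    have [zA|zA] := boolP (z \in A); last by have [_ _ ->] := cA z; rewrite ?cz.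
    by have /setP/(_ z) := B0; rewrite !inE zA cz eqxx => /negbT; rewrite negbK.
  by rewrite eqxx.
have B_flip0 z : (flip0 z \in B) = (z \in B) by rewrite !inE Aedge -flip02C !c0.
have evenB v : ~~ odd #|[set z in B | vertex_root z == v]|.
  pose Z := [set z | (c z == k) && (vertex_root z == v)].
  have : ~~ odd #|Z|.
    apply: (even_card_involution (@flip1K S)) => z; first by rewrite flip1_neq.
    by rewrite !inE c1 vE.
  suff : ~~ odd #|Z :\: B|.
    have -> : [set z in B | vertex_root z == v] = Z :&: B.
      by apply/setP=> z; rewrite !inE; case: (c z == k); rewrite /= ?andbF // andbC.
    by rewrite -(cardsID B Z) oddD => /negPf ->; rewrite addbF.
  apply: (even_card_involution (@flip2K S)) => z; first by rewrite flip2_neq.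
  rewrite !inE flip2K Aedge vE; case/andP=> zB /andP[/eqP cz ->].
  move: zB; rewrite cz eqxx andbT /=.
  have [zA /=|zA _] := boolP (z \in A); first by rewrite negbK andbF => ->.
  by have [_ _ ->] := cA z; rewrite // cz eqxx.
have partner z : z \in B -> exists2 z', z' \in B &
    z' != z /\ vertex_root z' = vertex_root z.
  move=> zB; have := evenB (vertex_root z).
  rewrite (cardsD1 z) inE zB eqxx /= negbK => oddD.
  have [z'|] := pickP [in [set y in B | vertex_root y == vertex_root z] :\ z].
    by rewrite in_setD1 inE => /and3P[? ? /eqP ?]; exists z'.
  by move/eq_card; rewrite card0 => D0; rewrite D0 in oddD.
have [b' b'B [b'b vb']] := partner b bB.
have [d dB [db vd]] := partner (flip0 b) (etrans (B_flip0 b) bB).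
have [d' d'B [db' vd']] := partner (flip0 b') (etrans (B_flip0 b') b'B).
have BA z : z \in B -> z \in A by rewrite !inE => /andP[].
have vb0 := loopless _ (BA _ bB); have vb'0 := loopless _ (BA _ b'B).
have vbb' : vertex_root (flip0 b) != vertex_root (flip0 b').
  apply/eqP => vbb'.
  have [/eqP|b'2] := simple _ _ (BA _ bB) (BA _ b'B) (esym vb') vbb'.
    by rewrite (negPf b'b).
  move: bB b'B; rewrite b'2 !inE flip2K => /and3P[_ _ nk] /and3P[_ k2 _].
  by rewrite k2 in nk.
(* The three pairs lie at the vertices of [b], [flip0 b] and [flip0 b']. *)
have uniq6 : uniq [:: b; b'; flip0 b; d; flip0 b'; d'].
  rewrite vb' in vb'0; have neq (y z : S) : vertex_root y != vertex_root z -> y != z.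
    by apply: contraNneq => ->.
  rewrite /= !inE !negb_or (eq_sym b b') b'b.
  rewrite (eq_sym (flip0 b) d) db (eq_sym (flip0 b') d') db' /=.
  by do !(apply/andP; split) => //; apply: neq; rewrite ?vd ?vd' ?vb' // eq_sym.
have /card_uniqP/= <- := uniq6; apply/subset_leq_card/subsetP => z.
suff: {subset [:: b; b'; flip0 b; d; flip0 b'; d'] <= B}.
  by move=> sB /sB; rewrite !inE => /and3P[-> ->].
by apply/allP; rewrite /= !B_flip0 bB b'B dB d'B.
Qed.

(** The classical [3V - 6 + 3g] bound for the number of edges, multiplied by
    four, with the genus expressed by the numbers of cells. *)
Lemma simple_edges_bound A W b :
  edge_set A -> simple_edges A -> 6 <= #|A| -> vertex_root b \in W ->
  (forall x, x \in A -> vertex_root x \in W) ->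
  12 * (vertex_number S + face_number S) + #|A|
    <= 12 * (edge_number S + #|W|).
Proof.
move=> Aedge Asimple le6A Wb AW.
have [c cA lec] := region_colouring_exists Aedge Wb AW.
suff : 6 * #|colours c| <= #|A| by lia.
rewrite mulnC -sum_nat_const -[#|A|]sum1_card.
rewrite [in leqRHS](partition_big c [in colours c]) /=; last first.
  by move=> x _; apply: imset_f.
apply: leq_sum => k kc; rewrite sum1_card.
apply: leq_trans (region_sides Aedge Asimple cA le6A kc) _.
by rewrite subset_leq_card //; apply/subsetP=> x; rewrite !inE.
Qed.

End Surface.

(** * Edges of graphs of bounded genus *)

Section Graph.
Variables (T : finType) (e : rel T).
Hypotheses (e_sym : symmetric e) (e_irr : irreflexive e).
Implicit Types (u v : T) (U : {set T}).

Definition arcs U : {set T * T} :=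
  [set a | [&& a.1 \in U, a.2 \in U & e a.1 a.2]].

Section Drawing.
Variables (S : surface) (p : T -> S).
Hypothesis p_drawing : drawing_on e p.

Definition drawn_flag u v : S :=
  odflt (p u)
    [pick x | same_vertex (p u) x && same_vertex (p v) (flip0 x)].

(** A drawing only provides, for each ordered pair of adjacent vertices, some
    edge of the decomposition, and the two orders might get parallel edges.
    Comparing the ranks of the ends makes the choice independent of the
    order. *)
Definition arc_flag (a : T * T) : S :=
  if enum_rank a.1 < enum_rank a.2 then drawn_flag a.1 a.2
  else flip0 (drawn_flag a.2 a.1).

Lemma drawn_flagP u v : e u v ->
  vertex_root (drawn_flag u v) = vertex_root (p u) /\
  vertex_root (flip0 (drawn_flag u v)) = vertex_root (p v).
Proof.
case: p_drawing => _ /[apply] -[x [ux vx]]; rewrite /drawn_flag.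
case: pickP => [y|/(_ x)]; last by rewrite ux vx.
by rewrite !same_vertexE => /andP[/eqP-> /eqP->].
Qed.

Lemma arc_flagP u v : e u v ->
  vertex_root (arc_flag (u, v)) = vertex_root (p u) /\
  vertex_root (flip0 (arc_flag (u, v))) = vertex_root (p v).
Proof.
rewrite /arc_flag /=; case: ifP => _ uv; first exact: drawn_flagP.
by rewrite flip0K; have [] := @drawn_flagP v u; rewrite // e_sym.
Qed.

Lemma flip0_arc_flag u v : e u v -> flip0 (arc_flag (u, v)) = arc_flag (v, u).
Proof.
move=> uv; rewrite /arc_flag /=; case: ltngtP => //; rewrite ?flip0K //.
by move/val_inj/enum_rank_inj => uv'; rewrite uv' e_irr in uv.
Qed.

Lemma arc_flag_inj a a' : e a.1 a.2 -> e a'.1 a'.2 ->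
  vertex_root (arc_flag a) = vertex_root (arc_flag a') ->
  vertex_root (flip0 (arc_flag a)) = vertex_root (flip0 (arc_flag a')) ->
  a = a'.
Proof.
case: a a' => [u v] [u' v'] /= /arc_flagP[-> ->] /arc_flagP[-> ->].
case: p_drawing => p_inj _ /eqP; rewrite -same_vertexE => /p_inj->.
by move/eqP; rewrite -same_vertexE => /p_inj->.
Qed.

Definition drawn_edges U : {set S} :=
  [set arc_flag a | a in arcs U] :|: [set flip2 (arc_flag a) | a in arcs U].

Lemma drawn_edgesP U (x : S) :
  reflect (exists2 a, a \in arcs U & x = arc_flag a \/ x = flip2 (arc_flag a))
          (x \in drawn_edges U).
Proof.
rewrite inE; apply: (iffP orP).
  by case=> /imsetP[a aU ->]; exists a => //; [left|right].
by case=> a aU [->|->]; [left|right]; apply: imset_f.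
Qed.

Lemma edge_set_drawn_edges U : edge_set (drawn_edges U).
Proof.
have step0 x : x \in drawn_edges U -> flip0 x \in drawn_edges U.
  case/drawn_edgesP => -[u v] uvU xa; apply/drawn_edgesP; exists (v, u).
    by move: uvU; rewrite !inE /= e_sym => /and3P[-> -> ->].
  have uv : e u v by move: uvU; rewrite inE => /and3P[].
  by case: xa => ->; rewrite ?flip02C flip0_arc_flag //; [left|right].
have step2 x : x \in drawn_edges U -> flip2 x \in drawn_edges U.
  case/drawn_edgesP => a aU xa; apply/drawn_edgesP; exists a => //.
  by case: xa => ->; [right|left]; rewrite ?flip2K.
move=> x; split; apply/idP/idP => [|//].
- by move/step0; rewrite flip0K.
- exact: step0.
- by move/step2; rewrite flip2K.
- exact: step2.
Qed.

Lemma simple_drawn_edges U : simple_edges (drawn_edges U).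
Proof.
split=> [x|x y] /drawn_edgesP[a aU xa].
  have ua : e a.1 a.2 by move: aU; rewrite inE => /and3P[].
  have -> : vertex_root (flip0 x) = vertex_root (flip0 (arc_flag a)).
    by case: xa => ->; rewrite ?flip02C ?vertex_root_flip2.
  have -> : vertex_root x = vertex_root (arc_flag a).
    by case: xa => ->; rewrite ?vertex_root_flip2.
  case: a ua {aU xa} => u v /= uv; have [-> ->] := arc_flagP uv.
  apply/eqP => /eqP; rewrite -same_vertexE.
  by case: p_drawing => p_inj _ /p_inj vu; rewrite vu e_irr in uv.
case/drawn_edgesP => b bU yb.
have ua : e a.1 a.2 by move: aU; rewrite inE => /and3P[].
have ub : e b.1 b.2 by move: bU; rewrite inE => /and3P[].
move=> vxy v0xy; suff ab : a = b.
  rewrite -{}ab in yb.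
  by case: xa yb => -> [] ->; rewrite ?flip2K; auto.
by apply: (arc_flag_inj ua ub); move: vxy v0xy;
  case: xa yb => -> [] ->; rewrite ?flip02C ?vertex_root_flip2.
Qed.

(** An arc of the graph, that is a directed edge, corresponds to the two flags
    at its origin on the chosen edge of the decomposition. *)
Lemma card_drawn_edges U : #|drawn_edges U| = 2 * #|arcs U|.
Proof.
have inj : {in arcs U &, injective arc_flag}.
  move=> a b; rewrite !inE => /and3P[_ _ ea] /and3P[_ _ eb] ab.
  by apply: arc_flag_inj; rewrite // ab.
rewrite cardsU (card_in_imset inj) card_in_imset; last first.
  by move=> a b aU bU /(inv_inj (@flip2K S)); apply: inj.
rewrite (_ : _ :&: _ = set0) ?cards0 ?subn0 ?mul2n ?addnn //.
apply/setP=> x; rewrite !inE; apply/negP=> /andP[/imsetP[a aU ->]].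
case/imsetP=> b bU ab; have /negP := flip2_neq (arc_flag b); apply.
rewrite -ab; apply/eqP; congr arc_flag.
move: aU bU; rewrite !inE => /and3P[_ _ ea] /and3P[_ _ eb].
by apply: arc_flag_inj; rewrite // ab ?flip02C vertex_root_flip2.
Qed.

(** Euler's formula gives [6|U| + 6g - 12] when [U] spans at least two edges;
    without the [- 12] the bound holds for all [U]. *)
Lemma card_arcs_drawing U (g : nat) :
  surface_euler_genus S = g%:Z%R -> #|arcs U| <= 6 * #|U| + 6 * g.
Proof.
rewrite /surface_euler_genus /surface_euler_char => genus_S.
have [->|[u uU]] := set_0Vmem U.
  rewrite (_ : arcs _ = set0) ?cards0 //.
  by apply/setP=> a; rewrite !inE.
have U_gt0 : 0 < #|U| by apply/card_gt0P; exists u.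
have [|le3] := leqP #|arcs U| 3; first by lia.
pose W := [set vertex_root (p v) | v in U].
have leWU : #|W| <= #|U| by apply: leq_imset_card.
have le6 : 6 <= #|drawn_edges U| by rewrite card_drawn_edges; lia.
have puW : vertex_root (p u) \in W by apply: imset_f.
have AW x : x \in drawn_edges U -> vertex_root x \in W.
  move=> /drawn_edgesP[[v w] vwU xvw].
  have -> : vertex_root x = vertex_root (arc_flag (v, w)).
    by case: xvw => ->; rewrite ?vertex_root_flip2.
  move: vwU; rewrite inE => /and3P[/= vU _ /arc_flagP[-> _]].
  exact: imset_f.
have := simple_edges_bound (edge_set_drawn_edges U) (simple_drawn_edges U)
          le6 puW AW.
by rewrite card_drawn_edges; lia.
Qed.

End Drawing.

Lemma card_arcs g U : has_euler_genus e g -> #|arcs U| <= 6 * #|U| + 6 * g.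
Proof.
by case=> -[S [[p p_drawing] genus_S]] _; apply: (card_arcs_drawing p_drawing).
Qed.

(** The statement is generalized to induced subgraphs and proved by removing a
    vertex [x] with at most 6 neighbours: all its edges are oriented away from
    it.  When there is no such vertex, seven times the number of vertices is at
    most [6|U| + 6g], so what is left can serve as the core. *)
Lemma sparse_orientation g :
  (forall U, #|arcs U| <= 6 * #|U| + 6 * g) ->
  exists (C : {set T}) (o : rel T),
  [/\ #|C| <= 6 * g,
      forall u, #|[set v | e u v && o u v]| <= 6 &
      forall u v, e u v -> ~~ ((u \in C) && (v \in C)) -> o u v || o v u].
Proof.
move=> sparse.
suff [C [o [lec deg_o tot_o]]] : exists (C : {set T}) (o : rel T),
  [/\ #|C| <= 6 * g,
      {in [set: T], forall u, #|[set v in [set: T] | e u v && o u v]| <= 6} &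
      {in [set: T] &, forall u v, e u v -> ~~ ((u \in C) && (v \in C)) ->
         o u v || o v u}].
  exists C, o; split=> // [u|u v]; last exact: tot_o.
  by apply: leq_trans (deg_o u (in_setT u)); apply/subset_leq_card/subsetP => v;
    rewrite !inE.
have [n] := ubnP #|[set: T]|; elim: n [set: T] => // n IHn U ltUn.
have [/existsP[x /andP[xU degx]]|noU] :=
  boolP [exists x in U, #|[set v in U | e x v]| <= 6].
  have [|C [o [lec deg_o tot_o]]] := IHn (U :\ x).
    by move: ltUn; rewrite (cardsD1 x) xU; lia.
  exists C, (fun u v => if u == x then true else if v == x then false else o u v).
  split=> // [u uU|u v uU vU uv nC].
    have [->|ux] := eqVneq u x.
      by under eq_finset do rewrite andbT.
    apply: leq_trans (deg_o u _); last by rewrite !inE ux.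
    by apply/subset_leq_card/subsetP => v; rewrite !inE; case: (v == x);
      rewrite ?andbF.
  have [ux|ux] := eqVneq u x => //.
  have [vx|vx] := eqVneq v x => //.
  by apply: tot_o; rewrite ?inE ?ux ?vx.
exists U, (fun _ _ => false); split=> [|u _|u v uU vU _]; first 1 last.
- by under eq_finset do rewrite !andbF; rewrite (_ : finset _ = set0) ?cards0 //.
- by rewrite uU vU.
suff : 7 * #|U| <= #|arcs U| by have := sparse U; lia.
rewrite mulnC -sum_nat_const -[leqRHS]sum1_card.
rewrite [leqRHS](partition_big fst [in U]) /=; last first.
  by move=> a; rewrite inE => /and3P[].
apply: leq_sum => u uU; rewrite sum1_card.
move: noU; rewrite negb_exists => /forallP/(_ u); rewrite uU /= -ltnNge.
move/leq_trans; apply.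
have pair_inj : injective (pair u : T -> T * T) by move=> v w [].
rewrite -(card_imset _ pair_inj); apply/subset_leq_card/subsetP => a.
case/imsetP=> v; rewrite inE => /andP[vU uv] ->.
by rewrite unfold_in inE /= uU vU uv eqxx.
Qed.

End Graph.

(** * Weights of walks *)

Local Open Scope ring_scope.

Lemma big_tuple_cons (V : nmodType) (T : finType) k (F : seq T -> V) :
  \sum_(w : k.+1.-tuple T) F w = \sum_v \sum_(w : k.-tuple T) F (v :: w).
Proof.
rewrite pair_bigA /= (reindex (fun a => cons_tuple a.1 a.2)) //=.
exists (fun w => (thead w, behead_tuple w)) => [[v w] _|w _] /=.
  by congr pair; apply: val_inj.
by rewrite [RHS]tuple_eta; apply: val_inj.
Qed.

Lemma big_tuple_nil (V : nmodType) (T : finType) (F : seq T -> V) :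
  \sum_(w : 0.-tuple T) F w = F [::].
Proof. by rewrite (big_pred1 [tuple]) // => w; apply/esym/eqP/tuple0. Qed.

Section WalkWeight.
Variables (R : realFieldType) (T : finType).
Implicit Types (s : T -> T -> R) (u v : T).

Fixpoint walk_weight s u (w : seq T) : R :=
  if w is v :: w' then s u v * walk_weight s v w' else 1.

Lemma walk_weight_ge0 s u w : (forall u v, 0 <= s u v) -> 0 <= walk_weight s u w.
Proof. by move=> s_ge0; elim: w u => //= v w IHw u; rewrite mulr_ge0. Qed.

Lemma sum_walk_weight_out s c k u :
  (forall u v, 0 <= s u v) -> (forall u, \sum_v s u v <= c) ->
  \sum_(w : k.-tuple T) walk_weight s u w <= c ^+ k.
Proof.
move=> s_ge0 s_le.
have c_ge0 : 0 <= c by apply: le_trans (s_le u); apply: sumr_ge0.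
elim: k u => [|k IHk] u.
  by rewrite big_tuple_nil.
rewrite big_tuple_cons /=; under eq_bigr do rewrite -mulr_sumr.
apply: le_trans (_ : \sum_v s u v * c ^+ k <= _).
  by apply: ler_sum => v _; rewrite ler_wpM2l.
by rewrite -mulr_suml exprS ler_wpM2r ?exprn_ge0.
Qed.

(** The column sums of [s] are bounded here in place of the row sums, as for the
    transpose of a matrix with bounded row sums.  There is then no bound for a
    fixed origin, only for the sum over all origins. *)
Lemma sum_walk_weight_in s c k :
  (forall u v, 0 <= s u v) -> 0 <= c -> (forall v, \sum_u s u v <= c) ->
  \sum_u \sum_(w : k.-tuple T) walk_weight s u w <= #|T|%:R * c ^+ k.
Proof.
move=> s_ge0 c_ge0 s_le; elim: k => [|k IHk].
  by under eq_bigr do rewrite big_tuple_nil; rewrite sumr_const mulr1.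
under eq_bigr do rewrite big_tuple_cons /=.
rewrite exchange_big exprS mulrCA /=.
apply: le_trans (_ : c * \sum_v \sum_(w : k.-tuple T) walk_weight s v w <= _).
  rewrite mulr_sumr; apply: ler_sum => v _.
  under eq_bigr do rewrite -mulr_sumr.
  rewrite -mulr_suml ler_wpM2r //.
  by apply: sumr_ge0 => w _; apply: walk_weight_ge0.
by rewrite ler_wpM2l.
Qed.

(** Forward and backward weights have the same total bound, and by the inequality
    of arithmetic and geometric means their sum is at least [2 / B] on [A]. *)
Lemma card_walks_weight s (c B : R) k (A : {set k.+1.-tuple T}) :
  (forall u v, 0 <= s u v) -> 0 <= c -> (forall u, \sum_v s u v <= c) ->
  0 <= B ->
  (forall u (w : k.-tuple T), [tuple of u :: w] \in A ->
     1 <= B ^+ 2 * (walk_weight s u w * walk_weight (fun x y => s y x) u w)) ->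
  #|A|%:R <= #|T|%:R * c ^+ k * B.
Proof.
move=> s_ge0 c_ge0 s_le B_ge0 A_ge.
set t := fun x y => s y x in A_ge *.
have t_ge0 u v : 0 <= t u v by apply: s_ge0.
pose F (w : seq T) := if w is u :: w' then
  B * (walk_weight s u w' + walk_weight t u w') else 0.
have F_ge0 w : 0 <= F w.
  by case: w => //= u w; rewrite mulr_ge0 ?addr_ge0 ?walk_weight_ge0.
suff : 2 * #|A|%:R <= 2 * (#|T|%:R * c ^+ k * B).
  by rewrite ler_pM2l.
apply: le_trans (_ : \sum_(w : k.+1.-tuple T) F w <= _).
  rewrite mulr_natr -sumr_const big_mkcond /=; apply: ler_sum => w _.
  case/tupleP: w => u w; case: ifP => // /A_ge /=.
  set a := walk_weight s u w; set b := walk_weight t u w => ab_ge.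
  have a_ge0 : 0 <= B * a by rewrite mulr_ge0 ?walk_weight_ge0.
  have b_ge0 : 0 <= B * b by rewrite mulr_ge0 ?walk_weight_ge0.
  have {}ab_ge : 1 <= (B * a) * (B * b) by rewrite mulrACA -expr2.
  rewrite mulrDr; move: a_ge0 b_ge0 ab_ge; move: (B * a) (B * b) => x y.
  have := sqr_ge0 (x - y); nra.
rewrite big_tuple_cons /=.
under eq_bigr do rewrite -mulr_sumr big_split /=.
rewrite -mulr_sumr big_split /= mulrA [leRHS]mulrC ler_wpM2l // mulrDl mul1r.
apply: lerD.
  rewrite [leRHS]mulrC [leRHS]mulr_natr -sumr_const.
  by apply: ler_sum => u _; apply: sum_walk_weight_out.
exact: sum_walk_weight_in.
Qed.

End WalkWeight.

(** * Weights of simple paths *)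

Section PathWeight.
Variables (R : realFieldType) (T : finType) (e o : rel T) (C : {set T}).
Variables (Delta : nat).
Hypotheses (Delta_ge6 : (6 <= Delta)%N).
Hypothesis deg_e : forall u, (#|[set v | e u v]| <= Delta)%N.
Hypothesis deg_o : forall u, (#|[set v | e u v && o u v]| <= 6)%N.
Hypothesis tot_o :
  forall u v, e u v -> ~~ ((u \in C) && (v \in C)) -> o u v || o v u.
Hypothesis e_sym : symmetric e.

Definition arc_weight u v : R :=
  if e u v then if o u v then 6^-1 else Delta%:R^-1 else 0.

Let D_ge6 : 6 <= Delta%:R :> R. Proof. by rewrite (ler_nat R 6). Qed.
Let D_gt0 : 0 < Delta%:R :> R. Proof. by rewrite ltr0n; lia. Qed.

Lemma arc_weight_ge0 u v : 0 <= arc_weight u v.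
Proof. by rewrite /arc_weight; do !case: ifP => _; rewrite ?invr_ge0 ?ler0n. Qed.

Lemma sum_arc_weight u : \sum_v arc_weight u v <= 2.
Proof.
apply: le_trans (_ : \sum_(v in [set v | e u v && o u v]) 6^-1 +
                     \sum_(v in [set v | e u v]) Delta%:R^-1 <= _).
  rewrite !(big_mkcond (fun v => v \in _)) -big_split /=; apply: ler_sum => v _.
  rewrite /arc_weight !inE; case: (e u v); rewrite ?addr0 //=.
  by case: (o u v); rewrite ?add0r // lerDl invr_ge0 ler0n.
rewrite !sumr_const -[6^-1 *+ _]mulr_natl -[Delta%:R^-1 *+ _]mulr_natl.
rewrite [leRHS](_ : 2 = 1 + 1) //; apply: lerD; rewrite ler_pdivrMr // mul1r.
  by rewrite (ler_nat R _ 6).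
by rewrite ler_nat.
Qed.

(** An edge outside the core is oriented one way or the other, so the product of
    its two weights is at least [1 / (6 Delta)].  In the core it may be
    [1 / Delta^2]; the extra factor [6 / Delta] is charged to the head [v], so
    that a simple path is charged at most [|C|] times. *)
Lemma arc_weight_both u v : e u v ->
  (6 * Delta%:R)^-1 * (6 / Delta%:R) ^+ (v \in C)
    <= arc_weight u v * arc_weight v u.
Proof.
move=> uv; rewrite /arc_weight -[e v u]e_sym uv invfM.
have := tot_o uv.
have Dx : Delta%:R^-1 <= 6^-1 :> R by rewrite lef_pV2 // posrE.
have x0 : 0 <= Delta%:R^-1 :> R by rewrite invr_ge0 ltW.
move: Dx x0; move: (Delta%:R^-1 : R) => x.
case: (v \in C); case: (o u v); case: (o v u); rewrite /= ?andbF //;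
  rewrite ?expr1 ?expr0; nra.
Qed.

Lemma path_weight_both u w : path e u w ->
  (6 * Delta%:R)^-1 ^+ size w * (6 / Delta%:R) ^+ count [in C] w
    <= walk_weight arc_weight u w
         * walk_weight (fun x y => arc_weight y x) u w.
Proof.
elim: w u => [|v w IHw] u /=; first by rewrite !expr0 mulr1.
case/andP=> uv /IHw vw; rewrite exprS exprD mulrACA [leRHS]mulrACA.
have w1 : 0 <= (6 * Delta%:R)^-1 :> R by rewrite invr_ge0 mulr_ge0 ?ler0n.
have w2 : 0 <= 6 / Delta%:R :> R by rewrite divr_ge0 ?ler0n.
by apply: ler_pM; rewrite ?arc_weight_both ?mulr_ge0 ?exprn_ge0.
Qed.

Lemma uniq_path_weight_both (c : nat) u w : path e u w -> uniq w ->
  (#|C| <= c)%N ->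
  (6 * Delta%:R)^-1 ^+ size w * (6 / Delta%:R) ^+ c
    <= walk_weight arc_weight u w
         * walk_weight (fun x y => arc_weight y x) u w.
Proof.
move=> uw w_uniq leC; apply: le_trans (path_weight_both uw).
rewrite ler_wpM2l ?exprn_ge0 ?invr_ge0 ?mulr_ge0 ?ler0n //.
rewrite ler_wiXn2l ?divr_ge0 ?ler0n // ?ler_pdivrMr ?mul1r //.
apply: leq_trans leC; rewrite -size_filter.
move/(filter_uniq [in C])/card_uniqP: w_uniq => <-.
by apply/subset_leq_card/subsetP => v; rewrite mem_filter => /andP[].
Qed.

End PathWeight.

Lemma sqr_path_bound (R : realType) (Delta L g : nat) : (0 < Delta)%N ->
  (6 `^ (L%:R / 2 - 3 * g%:R) * Delta%:R `^ (L%:R / 2 + 3 * g%:R)) ^+ 2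
   = ((6 * Delta%:R)^-1 ^+ L * (6 / Delta%:R) ^+ (6 * g))^-1 :> R.
Proof.
move=> D_gt0.
have sqr_powR (a x : R) : 0 < a -> (a `^ x) ^+ 2 = a `^ (2 * x).
  by move=> a_gt0; rewrite -powR_mulrn ?powR_ge0 // -powRrM mulrC.
have D0 : Delta%:R != 0 :> R by rewrite pnatr_eq0 -lt0n.
have six0 : 6 != 0 :> R by rewrite pnatr_eq0.
rewrite exprMn !sqr_powR ?ltr0n //.
have -> : 2 * (L%:R / 2 - 3 * g%:R) = L%:R - (6 * g)%:R :> R.
  by rewrite natrM; field.
have -> : 2 * (L%:R / 2 + 3 * g%:R) = L%:R + (6 * g)%:R :> R.
  by rewrite natrM; field.
rewrite !powRD ?D0 ?six0 ?implybT // powRN !powR_mulrn ?ler0n //.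
move: (6 * g)%N => k.
rewrite !exprMn !exprVn invfM !invrK exprMn; field.
by rewrite !expf_neq0.
Qed.

(** * The number of simple paths *)

Unset Implicit Arguments.

Theorem lemma5 (R : realType) (T : finType) (e : rel T)
    (e_sym : symmetric e) (e_irr : irreflexive e)
    (e_conn : forall u v : T, connect e u v)
    (n g D Delta : nat)
    (card_T : #|T| = n)
    (genus_e : has_euler_genus e g)
    (diam_e : graph_diameter e = D)
    (deg_e : max_degree e = Delta)
    (Delta_ge6 : (6 <= Delta)%N)
    (L : nat) (L_gt0 : (0 < L)%N) :
  (#|simple_paths e L|%:R : R) <=
    2 * n%:R * 2 ^+ L * 6 `^ (L%:R / 2 - 3 * g%:R)
      * Delta%:R `^ (L%:R / 2 + 3 * g%:R).
Proof.
have [C [o [leC deg_o tot_o]]] :=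
  sparse_orientation (fun U => card_arcs e_sym e_irr U genus_e).
have degD u : (#|[set v | e u v]| <= Delta)%N.
  by rewrite -deg_e; apply: (leq_bigmax u).
rewrite -!mulrA -card_T.
set X := 6 `^ _ * _.
have X_ge0 : 0 <= X by rewrite mulr_ge0 ?powR_ge0.
apply: le_trans (_ : #|T|%:R * 2 ^+ L * X <= _); last first.
  by rewrite -mulrA ler_peMl ?mulr_ge0 ?exprn_ge0 ?powR_ge0 ?ler0n ?ler1n.
apply: (@card_walks_weight _ _ (arc_weight R e o Delta)) => //.
- exact: arc_weight_ge0.
- exact: sum_arc_weight.
move=> u w; rewrite inE /= => /andP[uw /andP[_ w_uniq]].
have le_uw := uniq_path_weight_both R Delta_ge6 tot_o e_sym uw w_uniq leC.
have D_gt0 : (0 < Delta)%N by lia.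
rewrite sqr_path_bound // ler_pdivlMl ?mulr1.
  by rewrite -{1}(size_tuple w).
by rewrite mulr_gt0 ?exprn_gt0 ?invr_gt0 ?divr_gt0 ?mulr_gt0 ?ltr0n.
Qed.
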